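(* Consider the left-invariant system $\dot X = X[u]$ on the Lie group $G$ with output $y=h(X,\mathring y)\in M$ and biased input measurement $u_y=u+b$, where $b\in\mathfrak g$ is constant, together with the observer $$\dot{\hat X}=\hat X[u_y-\hat b]-\alpha_{\mathring y}(\hat X,y,\hat b,u_y,t),\qquad \dot{\hat b}=\beta_{\mathring y}(\hat X,y,\hat b,u_y,t),$$ where $\alpha_{\mathring y}\colon G\times M\times\mathfrak g\times\mathfrak g\times\mathbb R\to TG$ (with $\alpha_{\mathring y}(\hat X,\cdot)\in T_{\hat X}G$) and $\beta_{\mathring y}\colon G\times M\times\mathfrak g\times\mathfrak g\times\mathbb R\to\mathfrak g$ are parameterized vector fields on $G$ and $\mathfrak g$, respectively. Let $E=\hat XX^{-1}\in G$ and $\tilde b=\hat b-b\in\mathfrak g$. Then the error dynamics $(\dot E,\dot{\tilde b})$ is autonomous if and only if all of the following conditions hold: (a) $\alpha_{\mathring y}$ and $\beta_{\mathring y}$ do not depend on $\hat b$, $u_y$ and $t$ (so one may write $\alpha_{\mathring y}(\hat X,y)$ and $\beta_{\mathring y}(\hat X,y)$). (b) The vector field $\alpha_{\mathring y}$ is right equivariant: $T_{\hat X}R_Z\,\alpha_{\mathring y}(\hat X,y)=\alpha_{\mathring y}(\hat XZ,h(Z,y))$ for all $\hat X,Z\in G$ and all $y\in M$. (c) The vector field $\beta_{\mathring y}$ is right invariant: $\beta_{\mathring y}(\hat X,y)=\beta_{\mathring y}(\hat XZ,h(Z,y))$ for all $\hat X,Z\in G$ and all $y\in M$. (d) For all $Z\in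 G$ the adjoint map $\mathrm{Ad}_Z\colon\mathfrak g\to\mathfrak g$ is the identity map.
   Context: $G$ is a finite-dimensional real connected Lie group with Lie algebra $\mathfrak g\cong T_IG$ and identity $I$. $L_SX=SX$ and $R_SX=XS$ denote left and right multiplication; for $u\in\mathfrak g$, $S[u]:=T_IL_S[u]\in T_SG$ and $[u]S:=T_IR_S[u]\in T_SG$; $\mathrm{Ad}_S[u]:=T_SR_{S^{-1}}\circ T_IL_S[u]$. Outputs: $M_1,\dots,M_n$ are homogeneous spaces of $G$, with right actions $h_i\colon G\times M_i\to M_i$, i.e. $h_i(I,y_i)=y_i$ and $h_i(XS,y_i)=h_i(S,h_i(X,y_i))$. Fixed (constant) reference outputs $\mathring y_i\in M_i$ are given, and $y_i=h_i(X,\mathring y_i)$. Put $y=(y_1,\dots,y_n)$, $\mathring y=(\mathring y_1,\dots,\mathring y_n)$, $h(X,y)=(h_1(X,y_1),\dots,h_n(X,y_n))$, and let $M=\{h(X,\mathring y): X\in G\}\subset M_1\times\dots\times M_n$ be the orbit of $\mathring y$; $h$ is a transitive right action of $G$ on $M$. The reference output $\mathring y$ is a fixed parameter. The input $u\in\mathfrak g$ is a time function $t\mapsto u(t)$ that is arbitrary (continuous) and the bias $b\in\mathfrak g$ is an arbitrary unknown constant. The error dynamics is called autonomous if there exist functions $F_{\mathring y}\colon G\times\mathfrak g\to TG$ and $H_{\mathring y}\colon G\times\mathfrak g\to\mathfrak g$ such that, for all $X,\hat X\in G$ (with $y=h(X,\mathring y)$), all $\hat b,b,u\in\mathfrak g$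 (with $u_y=u+b$) and all $t$, the time derivatives induced by the system and observer satisfy $\dot E=F_{\mathring y}(E,\tilde b)$ and $\dot{\tilde b}=H_{\mathring y}(E,\tilde b)$ with $E=\hat XX^{-1}$, $\tilde b=\hat b-b$. *)

(* Defs.v *)
From HB Require Import structures.
From mathcomp Require Export all_boot all_order all_algebra.
From mathcomp Require Export all_classical all_reals all_analysis.
Export Order.TTheory GRing.Theory Num.Theory.
Export numFieldNormedType.Exports.

Set Implicit Arguments.
Unset Strict Implicit.
Unset Printing Implicit Defensive.

Local Open Scope classical_set_scope.
Local Open Scope ring_scope.

(* [U] is meant to be open.  In finite dimension, [f] is of class C^(k+1) iff
   it is differentiable and every directional derivative is of class C^k. *)
Fixpoint Ck_on (R : realType) (V W : normedModType R) (k : nat) (U : set V)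
    (f : V -> W) : Prop :=
  match k with
  | 0%N => forall x, U x -> {for x, continuous f}
  | k'.+1 => (forall x, U x -> differentiable f x) /\
             (forall v : V, Ck_on k' U (fun x => 'd f x v))
  end.

Definition smooth_on (R : realType) (V W : normedModType R) (U : set V)
    (f : V -> W) : Prop := forall k : nat, Ck_on k U f.

(* A homeomorphism between an open set of [M] and an open set of R^n.  The
   values of [cmap] outside [cdom], and of [cinv] outside the image of [cdom],
   are irrelevant. *)
Record chart (R : realType) (n : nat) (M : topologicalType) := Chart {
  cdom : set M;
  cmap : M -> 'rV[R]_n;
  cinv : 'rV[R]_n -> M;
  cdom_open : open cdom;
  cimg_open : open (cmap @` cdom);
  cmapK : forall p, cdom p -> cinv (cmap p) = p;
  cmap_continuous : {within cdom, continuous cmap};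
  cinv_continuous : {within cmap @` cdom, continuous cinv}
}.

(* [chart_at] picks a preferred chart around each point; it is used only to
   represent tangent vectors (see [tangent]). *)
HB.mixin Record isManifold (R : realType) M of Topological M := {
  mdim : nat;
  atlas : set (chart R mdim M);
  chart_at : M -> chart R mdim M;
  chart_at_atlas : forall p, atlas (chart_at p);
  chart_at_dom : forall p, cdom (chart_at p) p;
  transition_smooth : forall c d, atlas c -> atlas d ->
    smooth_on (cmap c @` (cdom c `&` cdom d)) (cmap d \o cinv c);
  manifold_hausdorff : hausdorff_space M;
  manifold_second_countable : @second_countable M
}.

#[short(type="manifoldType")]
HB.structure Definition Manifold (R : realType) :=
  {M of isManifold R M & Topological M}.

Definition smooth (R : realType) (M N : manifoldType R) (f : M -> N) : Prop :=
  continuous f /\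
  forall (c : chart R mdim M) (d : chart R mdim N), atlas c -> atlas d ->
    smooth_on (cmap c @` (cdom c `&` f @^-1` cdom d))
              (cmap d \o f \o cinv c).

(* Smoothness of a map from the product manifold, read in the product charts
   [c1 x c2], which take values in the normed space R^(n1) * R^(n2). *)
Definition smooth2 (R : realType) (M1 M2 N : manifoldType R)
    (f : M1 -> M2 -> N) : Prop :=
  continuous (fun p : M1 * M2 => f p.1 p.2) /\
  forall (c1 : chart R mdim M1) (c2 : chart R mdim M2) (d : chart R mdim N),
    atlas c1 -> atlas c2 -> atlas d ->
    smooth_on [set (cmap c1 p.1, cmap c2 p.2) | p in
                [set p : M1 * M2 |
                  [/\ cdom c1 p.1, cdom c2 p.2 & cdom d (f p.1 p.2)]]]
              (fun x : 'rV[R]_mdim * 'rV[R]_mdim =>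
                 cmap d (f (cinv c1 x.1) (cinv c2 x.2))).

(* A vector tangent to [M] at [p] is represented by its coordinates in the
   preferred chart at [p]; its coordinates in any other chart at [p] are
   obtained by applying the differential of the transition map. *)
Definition tangent (R : realType) (M : manifoldType R) (p : M) : Type :=
  'rV[R]_(@mdim R M).

HB.instance Definition _ (R : realType) (M : manifoldType R) (p : M) :=
  NormedModule.on (tangent p).

Definition tmap (R : realType) (M N : manifoldType R) (f : M -> N) (p : M)
    (v : tangent p) : tangent (f p) :=
  'd (cmap (chart_at (f p)) \o f \o cinv (chart_at p))
     (cmap (chart_at p) p) v.

Definition velocity (R : realType) (M : manifoldType R) (c : R -> M) (t : R)
    (v : tangent (c t)) : Prop :=
  {for t, continuous c} /\ is_derive t 1 (cmap (chart_at (c t)) \o c) v.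
Arguments velocity {R M} c t v.

HB.mixin Record isLieGroup (R : realType) G of Manifold R G & Group G := {
  mulg_smooth : @smooth2 R G G G (fun X Y => (X * Y)%g);
  invg_smooth : @smooth R G G (fun X => X^-1%g)
}.

#[short(type="lieGroupType")]
HB.structure Definition LieGroup (R : realType) :=
  {G of isLieGroup R G & Manifold R G & Group G}.

Notation lie_algebra G := (tangent (1%g : G)).

(* S[u].  The differential of [L_S] at the identity lands in the tangent space
   at [S * 1]; since [S * 1 = S], the preferred charts at these two points are
   the same and no transport is needed.  The same applies to [Ad]. *)
Definition left_vect (R : realType) (G : lieGroupType R) (S : G)
    (u : lie_algebra G) : tangent S := tmap (fun X : G => (S * X)%g) u.

Definition Ad (R : realType) (G : lieGroupType R) (S : G)
    (u : lie_algebra G) : lie_algebra G :=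
  tmap (fun X : G => (X * S^-1)%g) (left_vect S u).

Record homogeneous_space (R : realType) (G : lieGroupType R)
    (M : manifoldType R) := HomogeneousSpace {
  act :> G -> M -> M;
  act_smooth : smooth2 act;
  act1 : forall y, act 1%g y = y;
  actM : forall X S y, act (X * S)%g y = act S (act X y);
  act_transitive : forall y z, exists X, act X y = z
}.

Section Orbit.
Variables (R : realType) (G : lieGroupType R) (n : nat).
Variables (M : 'I_n -> manifoldType R).
Variables (h : forall i, homogeneous_space G (M i)).

Definition prod_act (X : G) (y : forall i, M i) : forall i, M i :=
  fun i => h i X (y i).

Variable y0 : forall i, M i.

Definition orbit : Type :=
  {y : forall i, M i | exists X, y = prod_act X y0}.

Definition output (X : G) : orbit :=
  exist _ (prod_act X y0) (ex_intro _ X erefl).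

Fact orbit_act_subproof (Z : G) (y : orbit) :
  exists X, prod_act Z (sval y) = prod_act X y0.
Proof.
case: y => y [X yX] /=; exists (X * Z)%g.
by apply: functional_extensionality_dep => i; rewrite yX /prod_act actM.
Qed.

Definition orbit_act (Z : G) (y : orbit) : orbit :=
  exist _ (prod_act Z (sval y)) (orbit_act_subproof Z y).

End Orbit.

Section Observer.
Variables (R : realType) (G : lieGroupType R) (n : nat).
Variables (M : 'I_n -> manifoldType R).
Variables (h : forall i, homogeneous_space G (M i)) (y0 : forall i, M i).
Local Notation g := (lie_algebra G).
Local Notation Y := (orbit h y0).

Variables (alpha : forall Xh : G, Y -> g -> g -> R -> tangent Xh)
          (beta : G -> Y -> g -> g -> R -> g).

Definition system_at (u : R -> g) (X : R -> G) (t : R) : Prop :=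
  velocity X t (left_vect (X t) (u t)).

Definition observer_at (y : R -> Y) (uy : R -> g) (Xh : R -> G) (bh : R -> g)
    (t : R) : Prop :=
  velocity Xh t (left_vect (Xh t) (uy t - bh t)
                 - alpha (Xh t) (y t) (bh t) (uy t) t) /\
  is_derive t 1 bh (beta (Xh t) (y t) (bh t) (uy t) t).

(* The equations are imposed only at the instant [t], so [X t], [Xh t], [bh t],
   [b], [u t] and [t] range over all possible values even when [alpha] and
   [beta] are so irregular that the observer has no solution on an interval. *)
Definition autonomous_error : Prop :=
  exists (F : forall E : G, g -> tangent E) (H : G -> g -> g),
  forall (X Xh : R -> G) (bh u : R -> g) (b : g) (t : R),
    let y := fun s => output h y0 (X s) in
    let uy := fun s => u s + b in
    let E := fun s => (Xh s * (X s)^-1)%g in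
    let bt := fun s => bh s - b in
    continuous u ->
    system_at u X t ->
    observer_at y uy Xh bh t ->
    velocity E t (F (E t) (bt t)) /\ is_derive t 1 bt (H (E t) (bt t)).

End Observer.

(* Main.v *)
Require Import Defs.

(* Differentiating [Xh = E X] with [X' = X[u]] gives
   [E' = T R_{X^-1} (Xh' - Xh[u]) = - E[Ad_X bt] - T R_{X^-1} alpha], while
   [bt' = beta].  Autonomy means that, for fixed [E] and [bt], both right-hand
   sides do not depend on [X], [bh], [uy] and [t].  At [bt = 0] (i.e. [b = bh])
   this is exactly (a), (b) and (c), because [Xh X^-1] is unchanged when [X] and
   [Xh] are right-translated by the same [Z]; comparing [bt = u] with [bt = 0]
   at equal values of the arguments of [alpha] leaves [Ad_X u = Ad_1 u = u]. *)

Set Implicit Arguments.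
Unset Strict Implicit.
Unset Printing Implicit Defensive.

Local Open Scope classical_set_scope.
Local Open Scope ring_scope.

(** * Derivatives of curves and partial differentials in normed spaces *)

Section Calculus.
Context {R : realType} {V W : normedModType R}.

Lemma is_derive1_comp_diff (f : R -> V) (g : V -> W) (t : R) (df : V) :
  is_derive t 1 f df -> differentiable g (f t) ->
  is_derive t 1 (g \o f) ('d g (f t) df).
Proof.
move=> [fD fE] gD.
have fd : differentiable f t by exact/derivable1_diffP.
have gfd : differentiable (g \o f) t by exact: differentiable_comp.
apply: DeriveDef; first exact/derivable1_diffP.
by rewrite deriveE // diff_comp //= -fE deriveE.
Qed.

Lemma is_derive1_pair (f : R -> V) (g : R -> W) (t : R) (df : V) (dg : W) :
  is_derive t 1 f df -> is_derive t 1 g dg ->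
  is_derive t 1 (fun s => (f s, g s)) (df, dg).
Proof.
move=> [fD fE] [gD gE].
have fd : differentiable f t by exact/derivable1_diffP.
have gd : differentiable g t by exact/derivable1_diffP.
have fgd : differentiable (fun s => (f s, g s)) t by exact: differentiable_pair.
apply: DeriveDef; first exact/derivable1_diffP.
by rewrite deriveE // diff_pair //= -fE -gE !deriveE.
Qed.

Lemma is_derive1_uniq (f : R -> V) (t : R) (v w : V) :
  is_derive t 1 f v -> is_derive t 1 f w -> v = w.
Proof. by move=> [_ <-] [_ <-]. Qed.

End Calculus.

(** This line takes the value [w] at time [t]; it serves to prescribe a value and a derivative at
    one instant. *)
Lemma is_derive1_affine {R : realType} {V : normedModType R} (t : R)
    (v w : V) :
  is_derive t 1 (fun s => (s - t) *: v + w) v.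
Proof.
have sD : is_derive t 1 (fun s : R => s - t) 1.
  by apply: is_derive_eq; rewrite subr0.
have vD : differentiable (fun x : R => x *: v) (t - t) by [].
have := is_deriveD (is_derive1_comp_diff sD vD) (is_derive_cst w t 1).
by rewrite addr0 diff_val scale1r.
Qed.

Section PartialDifferentials.
Context {R : realType} {V1 V2 W : normedModType R}.

Lemma diff_comp_pairl (g : V1 * V2 -> W) (x : V1) (y : V2) (v : V1) :
  differentiable g (x, y) -> 'd (g \o pair^~ y) x v = 'd g (x, y) (v, 0).
Proof.
move=> gD; have pD : differentiable (pair^~ y) x by exact: differentiable_pair.
rewrite diff_comp //= diff_pair //=.
rewrite (_ : 'd (fun=> y) x = cst 0 :> (_ -> _)); last exact: diff_cst.
by rewrite (_ : 'd (fun z => z) x = id :> (_ -> _)); last exact: diff_val.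
Qed.

Lemma diff_comp_pairr (g : V1 * V2 -> W) (x : V1) (y : V2) (v : V2) :
  differentiable g (x, y) -> 'd (g \o pair x) y v = 'd g (x, y) (0, v).
Proof.
move=> gD; have pD : differentiable (pair x) y by exact: differentiable_pair.
rewrite diff_comp //= diff_pair //=.
rewrite (_ : 'd (fun=> x) y = cst 0 :> (_ -> _)); last exact: diff_cst.
by rewrite (_ : 'd (fun z => z) y = id :> (_ -> _)); last exact: diff_val.
Qed.

End PartialDifferentials.

(** * Velocities of curves and tangent maps on manifolds *)

Section Manifolds.
Context {R : realType}.
Implicit Types M N : manifoldType R.

Lemma chart_inv_continuous M (c : chart R (@mdim R M) M) (p : M) :
  cdom c p -> {for cmap c p, continuous (cinv c)}.
Proof.
move=> cp; have := @cinv_continuous _ _ _ c.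
rewrite continuous_open_subspace; last exact: cimg_open.
by apply; rewrite inE; exists p.
Qed.

Lemma chart_atK M (p : M) : cinv (chart_at p) (cmap (chart_at p) p) = p.
Proof. exact/cmapK/chart_at_dom. Qed.

Lemma near_cdom M (p : M) : \forall x \near p, cdom (chart_at p) x.
Proof.
by apply: open_nbhs_nbhs; split; [exact: cdom_open|exact: chart_at_dom].
Qed.

(** The curve is a straight line in the preferred chart at [p], carried to the manifold by [cinv];
    only its behaviour near [t] matters. *)
Lemma curve_with_velocity M (t : R) (p : M) (v : 'rV[R]_(@mdim R M)) :
  exists c : R -> M, c t = p /\ @velocity R M c t v.
Proof.
pose l (s : R) := (s - t) *: v + cmap (chart_at p) p.
have lt : l t = cmap (chart_at p) p by rewrite /l subrr scale0r add0r.
have lD : is_derive t 1 l v by exact: is_derive1_affine.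
have lC : {for t, continuous l}.
  by apply: differentiable_continuous; apply/derivable1_diffP; case: lD.
exists (cinv (chart_at p) \o l).
have ct : (cinv (chart_at p) \o l) t = p by rewrite /= lt chart_atK.
split=> //; split.
  apply: continuous_comp => //; rewrite lt.
  exact/chart_inv_continuous/chart_at_dom.
rewrite ct; apply: near_eq_is_derive lD.
(* [cmap] undoes [cinv] only on the chart image, which is open and therefore contains [l s] for [s]
   near [t]. *)
have /lC : nbhs (l t) (cmap (chart_at p) @` cdom (chart_at p)).
  apply: open_nbhs_nbhs; split; first exact: cimg_open.
  by rewrite lt; exists p => //; exact: chart_at_dom.
apply: (@filterS R (nbhs t)) => s [q dq /= <-].
by rewrite cmapK.
Qed.

Lemma velocity_uniq M (c : R -> M) (t : R) (v w : tangent (c t)) :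
  velocity c t v -> velocity c t w -> v = w.
Proof. by move=> [_ vD] [_ wD]; exact: is_derive1_uniq vD wD. Qed.

(** Continuity is a separate requirement: chart maps have arbitrary values off their domains, so
    differentiability of the local expression does not imply it. *)
Definition mdifferentiable M N (f : M -> N) (p : M) :=
  {for p, continuous f} /\
  differentiable (cmap (chart_at (f p)) \o f \o cinv (chart_at p))
    (cmap (chart_at p) p).

Lemma velocity_comp M N (f : M -> N) (c : R -> M) (t : R) (v : tangent (c t)) :
  mdifferentiable f (c t) -> velocity c t v -> velocity (f \o c) t (tmap f v).
Proof.
move=> [fC fD] [cC cD]; split; first exact: continuous_comp.
have := is_derive1_comp_diff cD fD.
apply: near_eq_is_derive.
have := cC _ (near_cdom (c t)); apply: (@filterS R (nbhs t)) => s ds /=.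
by rewrite cmapK.
Qed.

Lemma smooth_mdifferentiable M N (f : M -> N) (p : M) :
  smooth f -> mdifferentiable f p.
Proof.
move=> [fC fS]; split; first exact: fC.
have [+ _] := fS _ _ (chart_at_atlas p) (chart_at_atlas (f p)) 1%N.
by apply; exists p => //; split => /=; exact: chart_at_dom.
Qed.

Section Smooth2.
Context {M1 M2 N : manifoldType R} {f : M1 -> M2 -> N}.
Hypothesis fS : smooth2 f.

Let floc (p1 : M1) (p2 : M2) (x : 'rV[R]_(@mdim R M1) * 'rV[R]_(@mdim R M2)) :=
  cmap (chart_at (f p1 p2))
    (f (cinv (chart_at p1) x.1) (cinv (chart_at p2) x.2)).

Let floc_diff p1 p2 :
  differentiable (floc p1 p2) (cmap (chart_at p1) p1, cmap (chart_at p2) p2).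
Proof.
have [+ _] := fS.2 _ _ _ (chart_at_atlas p1) (chart_at_atlas p2)
                (chart_at_atlas (f p1 p2)) 1%N.
by apply; exists (p1, p2) => //; split => /=; exact: chart_at_dom.
Qed.

Let floc_fixr p1 p2 : cmap (chart_at (f p1 p2)) \o (f ^~ p2) \o
  cinv (chart_at p1) = floc p1 p2 \o (fun x => (x, cmap (chart_at p2) p2)).
Proof. by apply/funext => x; rewrite /floc /= chart_atK. Qed.

Let floc_fixl p1 p2 : cmap (chart_at (f p1 p2)) \o f p1 \o
  cinv (chart_at p2) = floc p1 p2 \o (fun x => (cmap (chart_at p1) p1, x)).
Proof. by apply/funext => x; rewrite /floc /= chart_atK. Qed.

Lemma smooth2_mdifferentiablel (p1 : M1) (p2 : M2) :
  mdifferentiable (f ^~ p2) p1.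
Proof.
split.
  apply: (@continuous_comp _ _ _ (fun x => (x, p2)) (fun p => f p.1 p.2)).
    by apply: cvg_pair => //=; exact: cvg_cst.
  exact: fS.1.
rewrite floc_fixr; apply: differentiable_comp; last exact: floc_diff.
exact: differentiable_pair.
Qed.

Lemma smooth2_mdifferentiabler (p1 : M1) (p2 : M2) : mdifferentiable (f p1) p2.
Proof.
split.
  apply: (@continuous_comp _ _ _ (fun x => (p1, x)) (fun p => f p.1 p.2)).
    by apply: cvg_pair => //=; exact: cvg_cst.
  exact: fS.1.
rewrite floc_fixl; apply: differentiable_comp; last exact: floc_diff.
exact: differentiable_pair.
Qed.

(** Chain rule for the joint local expression [floc], whose differential at [(v1, v2)] splits into
    those at [(v1, 0)] and [(0, v2)]. For the group law this is the product rule. *)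
Lemma velocity2 (c1 : R -> M1) (c2 : R -> M2) (t : R)
    (v1 : tangent (c1 t)) (v2 : tangent (c2 t)) :
  velocity c1 t v1 -> velocity c2 t v2 ->
  velocity (fun s => f (c1 s) (c2 s)) t
    (tmap (f ^~ (c2 t)) v1 + tmap (f (c1 t)) v2).
Proof.
move=> [c1C c1D] [c2C c2D]; split.
  apply: (@continuous_comp _ _ _ (fun s => (c1 s, c2 s)) (fun p => f p.1 p.2)).
    exact: cvg_pair.
  exact: fS.1.
have -> : tmap (f ^~ (c2 t)) v1 + tmap (f (c1 t)) v2 =
    'd (floc (c1 t) (c2 t)) (cmap (chart_at (c1 t)) (c1 t),
      cmap (chart_at (c2 t)) (c2 t)) (v1, v2).
  rewrite /tmap floc_fixr floc_fixl.
  rewrite diff_comp_pairl // diff_comp_pairr // -linearD.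
  by congr ('d _ _ (_, _)); rewrite ?addr0 ?add0r.
have := is_derive1_comp_diff (is_derive1_pair c1D c2D)
  (floc_diff (c1 t) (c2 t)).
apply: near_eq_is_derive.
have : \forall s \near t, cdom (chart_at (c1 t)) (c1 s) /\
                          cdom (chart_at (c2 t)) (c2 s).
  by apply: filterI; [exact: (c1C _ (near_cdom _))|
                      exact: (c2C _ (near_cdom _))].
apply: (@filterS R (nbhs t)) => s [d1 d2] /=.
by rewrite /floc /= !cmapK.
Qed.

End Smooth2.

(* Every tangent vector is the velocity of a curve, so the chain rule for curves
   gives functoriality of [tmap] without composing differentials. *)
Lemma tmap_comp_eq (M N N' P : manifoldType R) (f1 : M -> N) (f2 : N -> P)
    (g1 : M -> N') (g2 : N' -> P) (p : M) (v : tangent p) :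
  mdifferentiable f1 p -> mdifferentiable f2 (f1 p) ->
  mdifferentiable g1 p -> mdifferentiable g2 (g1 p) ->
  f2 \o f1 =1 g2 \o g1 ->
  tmap f2 (tmap f1 v) = tmap g2 (tmap g1 v) :> 'rV[R]_(@mdim R P).
Proof.
have [c [cp]] := curve_with_velocity 0 p v.
case: p / cp in v * => cv f1D f2D g1D g2D /funext fg.
have fv := velocity_comp (c := f1 \o c) f2D (velocity_comp f1D cv).
have := velocity_comp (c := g1 \o c) g2D (velocity_comp g1D cv).
rewrite compA -fg => gv.
exact: velocity_uniq fv gv.
Qed.

Lemma tmap_id M (f : M -> M) (p : M) (v : tangent p) :
  mdifferentiable f p -> f =1 id -> tmap f v = v :> 'rV[R]_(@mdim R M).
Proof.
have [c [cp]] := curve_with_velocity 0 p v.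
case: p / cp in v * => cv fD /funext fE.
have fv := velocity_comp fD cv.
have fcE : f \o c = c by rewrite fE.
rewrite fcE in fv.
exact: velocity_uniq fv cv.
Qed.

End Manifolds.

(** * Translations of the Lie group and the velocity of the error *)

Section Translations.
Context {R : realType} {G : lieGroupType R}.
Implicit Types S T p : G.
Local Notation V := 'rV[R]_(@mdim R G).

(* All tangent spaces of [G] are convertible to [V], so that forgetting the base
   points in the types lets one rewrite them. *)
Definition dleft S p (v : V) : V :=
  tmap (M := G) (N := G) (fun X : G => (S * X)%g) (p := p) v.

Definition dright S p (v : V) : V :=
  tmap (M := G) (N := G) (fun X : G => (X * S)%g) (p := p) v.

Lemma mulgl_mdifferentiable S p : mdifferentiable (fun X : G => (S * X)%g) p.
Proof. exact: (smooth2_mdifferentiabler mulg_smooth). Qed.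

Lemma mulgr_mdifferentiable S p : mdifferentiable (fun X : G => (X * S)%g) p.
Proof. exact: (smooth2_mdifferentiablel mulg_smooth). Qed.

Lemma drightB S p v w : dright S p (v - w) = dright S p v - dright S p w.
Proof. exact: raddfB. Qed.

Lemma drightN S p v : dright S p (- v) = - dright S p v.
Proof. exact: raddfN. Qed.

Lemma dleftB S p v w : dleft S p (v - w) = dleft S p v - dleft S p w.
Proof. exact: raddfB. Qed.

Lemma dleftN S p v : dleft S p (- v) = - dleft S p v.
Proof. exact: raddfN. Qed.

Lemma dleft0 S p : dleft S p 0 = 0.
Proof. exact: raddf0. Qed.

Lemma dleft1 p v : dleft 1%g p v = v.
Proof.
by apply: tmap_id => [|X]; [exact: mulgl_mdifferentiable|rewrite mul1g].
Qed.

Lemma dright1 p v : dright 1%g p v = v.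
Proof.
by apply: tmap_id => [|X]; [exact: mulgr_mdifferentiable|rewrite mulg1].
Qed.

Lemma dleftM S T p v : dleft S (T * p)%g (dleft T p v) = dleft (S * T)%g p v.
Proof.
(* [tmap_comp_eq] compares two composites of two maps, so the right-hand side is padded with the
   translation by [1]. *)
rewrite -[RHS](dleft1 (S * T * p)%g).
apply: (@tmap_comp_eq R G G G G (fun X => T * X)%g (fun X => S * X)%g
  (fun X => S * T * X)%g (fun X => 1 * X)%g) => [||||X /=];
  [exact: mulgl_mdifferentiable..|].
by rewrite mul1g mulgA.
Qed.

Lemma drightM S T p v :
  dright S (p * T)%g (dright T p v) = dright (T * S)%g p v.
Proof.
rewrite -[RHS](dright1 (p * (T * S))%g).
apply: (@tmap_comp_eq R G G G G (fun X => X * T)%g (fun X => X * S)%g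
  (fun X => X * (T * S))%g (fun X => X * 1)%g) => [||||X /=];
  [exact: mulgr_mdifferentiable..|].
by rewrite mulg1 mulgA.
Qed.

Lemma dleft_dright S T p v :
  dleft S (p * T)%g (dright T p v) = dright T (S * p)%g (dleft S p v).
Proof.
apply: (@tmap_comp_eq R G G G G (fun X => X * T)%g (fun X => S * X)%g
  (fun X => S * X)%g (fun X => X * T)%g) => [||||X /=]; last by rewrite mulgA.
- exact: mulgr_mdifferentiable.
- exact: mulgl_mdifferentiable.
- exact: mulgl_mdifferentiable.
- exact: mulgr_mdifferentiable.
Qed.

Lemma drightK S p v : dright S^-1%g (p * S)%g (dright S p v) = v.
Proof. by rewrite drightM mulgV dright1. Qed.

Lemma drightVK S p v : dright S (p * S^-1)%g (dright S^-1%g p v) = v.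
Proof. by rewrite drightM mulVg dright1. Qed.

(** Smoothness of product and inverse only yields that [E] has some velocity [e]; differentiating
    [E X = Xh] then determines [e], so the differential of inversion is never computed. *)
Lemma velocity_error (X Xh : R -> G) (t : R) (u w : V) :
  @velocity R G X t (dleft (X t) 1%g u) -> @velocity R G Xh t w ->
  @velocity R G (fun s => (Xh s * (X s)^-1)%g) t
    (dright (X t)^-1%g (Xh t) (w - dleft (Xh t) 1%g u)).
Proof.
move=> Xv Xhv; set E := fun s => (Xh s * (X s)^-1)%g.
have [e Ev] : exists e : V, @velocity R G E t e.
  have Xiv := velocity_comp (smooth_mdifferentiable (X t) invg_smooth) Xv.
  by eexists; exact: (velocity2 mulg_smooth Xhv Xiv).
have EXv := velocity2 mulg_smooth Ev Xv.
have EX : (fun s => (E s * X s)%g) = Xh by apply/funext => s; rewrite mulgVK.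
rewrite EX in EXv.
have -> : w = dright (X t) (E t) e + dleft (E t) (X t) (dleft (X t) 1%g u).
  exact: velocity_uniq Xhv EXv.
have := dleftM (E t) (X t) 1%g u; rewrite mulg1 mulgVK => ->.
have := drightK (X t) (E t) e; rewrite mulgVK => eE.
by rewrite addrK eE.
Qed.

(** With the velocity of the observer for [Xh], the input [u] cancels and only the bias error
    [bh - b] and the correction [w] remain. *)
Lemma velocity_error_bias (X Xh : R -> G) (t : R) (u b bh w : V) :
  @velocity R G X t (dleft (X t) 1%g u) ->
  @velocity R G Xh t (dleft (Xh t) 1%g (u + b - bh) - w) ->
  @velocity R G (fun s => (Xh s * (X s)^-1)%g) t
    (dright (X t)^-1%g (Xh t) (- dleft (Xh t) 1%g (bh - b) - w)).
Proof.
move=> Xv /(velocity_error Xv); congr (velocity _ _ (dright _ _ _)).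
rewrite addrAC -dleftB; congr (_ - w).
rewrite -dleftN; congr (dleft _ _ _).
by rewrite opprB addrAC [u + b]addrC addrK.
Qed.

End Translations.

(** * Autonomy as equations between values at one instant *)

Section Observer.
Context {R : realType} {G : lieGroupType R} {n : nat}.
Context {M : 'I_n -> manifoldType R}.
Context {h : forall i, homogeneous_space G (M i)} {y0 : forall i, M i}.
Local Notation g := (lie_algebra G).
Local Notation Y := (orbit h y0).
Context {alpha : forall Xh : G, Y -> g -> g -> R -> tangent Xh}.
Context {beta : G -> Y -> g -> g -> R -> g}.

Lemma orbit_eq (y z : Y) : sval y = sval z -> y = z.
Proof.
by case: y z => [y yP] [z zP] /= yz; subst z; rewrite (Prop_irrelevance yP zP).
Qed.

Lemma outputP (y : Y) : exists X, y = output h y0 X.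
Proof. by case: (y) => z [X zX]; exists X; exact: orbit_eq. Qed.

Lemma orbit_act_output (X Z : G) :
  orbit_act Z (output h y0 X) = output h y0 (X * Z)%g.
Proof.
by apply/orbit_eq/functional_extensionality_dep => i; rewrite /= /prod_act actM.
Qed.

(** Any values are attained at [t] by curves with the prescribed velocities there, and uniqueness of
    velocities turns autonomy into equations. Conversely, the equations identify the computed
    velocities with [F] and [H]. *)
Lemma autonomous_errorE : autonomous_error alpha beta <->
  exists (F : forall E : G, g -> tangent E) (H : G -> g -> g),
  forall (X Xh : G) (bh uy b : g) (t : R),
    F (Xh * X^-1)%g (bh - b) = dright X^-1%g Xh
      (- dleft Xh 1%g (bh - b) - alpha Xh (output h y0 X) bh uy t) /\
    H (Xh * X^-1)%g (bh - b) = beta Xh (output h y0 X) bh uy t.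
Proof.
split=> -[F [H FH]]; exists F, H.
  move=> X0 Xh0 bh0 uy b t.
  have [X [Xt Xv]] := @curve_with_velocity R G t X0 (left_vect X0 (uy - b)).
  have [Xh [Xht Xhv]] := @curve_with_velocity R G t Xh0
    (left_vect Xh0 (uy - bh0) - alpha Xh0 (output h y0 X0) bh0 uy t).
  (* The observer equation is required at [t] only, so an affine [bh] suffices. *)
  pose bh (s : R) := (s - t) *: beta Xh0 (output h y0 X0) bh0 uy t + bh0.
  have bht : bh t = bh0 by rewrite /bh subrr scale0r add0r.
  (* The constant input [uy - b] is continuous and makes the biased measurement equal to [uy]. *)
  have Xs : system_at (fun=> uy - b) X t by rewrite /system_at Xt.
  have Xho : observer_at alpha beta (fun s => output h y0 (X s))
      (fun=> uy - b + b) Xh bh t.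
    split; first by rewrite subrK bht Xt Xht.
    by rewrite subrK bht Xt Xht; exact: is_derive1_affine.
  have [Ev bv] := FH X Xh bh (fun=> uy - b) b t (@cst_continuous _ _ _) Xs Xho.
  split; last first.
    have := is_derive1_uniq bv (is_deriveB Xho.2 (is_derive_cst b t 1)).
    by rewrite subrK bht Xt Xht subr0.
  have := velocity_uniq Ev (velocity_error_bias Xs Xho.1).
  by rewrite subrK bht Xt Xht => ->.
move=> X Xh bh u b t y uy E bt uC Xv [Xhv bhD].
have [FE HE] := FH (X t) (Xh t) (bh t) (uy t) b t.
split; last first.
  by rewrite HE -[X in is_derive _ _ _ X]subr0; apply: is_deriveB.
by rewrite FE; exact: velocity_error_bias Xv Xhv.
Qed.

End Observer.

Theorem theorem4p1 (R : realType) (G : lieGroupType R)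
    (G_connected : connected [set: G])
    (n : nat) (M : 'I_n -> manifoldType R)
    (h : forall i, homogeneous_space G (M i)) (y0 : forall i, M i)
    (alpha : forall Xh : G, orbit h y0 -> lie_algebra G -> lie_algebra G -> R ->
             tangent Xh)
    (beta : G -> orbit h y0 -> lie_algebra G -> lie_algebra G -> R ->
            lie_algebra G) :
  autonomous_error alpha beta <->
  [/\ (* (a) *)
      (forall Xh y bh bh' uy uy' t t',
         alpha Xh y bh uy t = alpha Xh y bh' uy' t' /\
         beta Xh y bh uy t = beta Xh y bh' uy' t'),
      (* (b) *)
      (forall (Xh Z : G) y bh uy t,
         tmap (fun X : G => (X * Z)%g) (alpha Xh y bh uy t) =
         alpha (Xh * Z)%g (orbit_act Z y) bh uy t),
      (* (c) *)
      (forall (Xh Z : G) y bh uy t,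
         beta Xh y bh uy t = beta (Xh * Z)%g (orbit_act Z y) bh uy t)
    & (* (d) *)
      (forall (Z : G) (u : lie_algebra G), Ad Z u = u)].
Proof.
rewrite autonomous_errorE; split=> [[F [H FH]]|[indep_a alphaR betaR Ad_id]].
  have F0 X Xh bh uy t : F (Xh * X^-1)%g 0 =
      - dright X^-1%g Xh (alpha Xh (output h y0 X) bh uy t).
    have [+ _] := FH X Xh bh uy bh t.
    by rewrite subrr dleft0 oppr0 sub0r drightN.
  have H0 X Xh bh uy t :
      H (Xh * X^-1)%g 0 = beta Xh (output h y0 X) bh uy t.
    by have [_ <-] := FH X Xh bh uy bh t; rewrite subrr.
  have EZ X Xh Z : (Xh * Z * (X * Z)^-1 = Xh * X^-1 :> G)%g.
    by rewrite invgM mulgA mulgK.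
  (* Solving for [alpha] leaves a right-hand side free of [bh], [uy] and [t]; this gives (a) for
     [alpha] and, with [EZ], also (b). *)
  have alphaE X Xh bh uy t : alpha Xh (output h y0 X) bh uy t =
      - dright X (Xh * X^-1)%g (F (Xh * X^-1)%g 0).
    by rewrite (F0 X Xh bh uy t) drightN opprK drightVK.
  split.
  - move=> Xh y bh bh' uy uy' t t'; have [X ->] := outputP y.
    by rewrite !alphaE -!H0.
  - move=> Xh Z y bh uy t; have [X ->] := outputP y.
    rewrite orbit_act_output !alphaE EZ.
    rewrite -[LHS]/(dright Z Xh (- _)) drightN.
    by rewrite -drightM mulgVK.
  - move=> Xh Z y bh uy t; have [X ->] := outputP y.
    by rewrite orbit_act_output -!H0 EZ.
  (* Taking [X = Xh = Z] fixes [E = 1]. The bias errors [u] and [0] share the same [alpha] term,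
     since [bh = u] in both cases, with [b = 0] and [b = u]. *)
  - have F1 Z u : F 1%g u = F 1%g 0 - Ad Z u.
      have [+ _] := FH Z Z u 0 0 0.
      rewrite subr0 drightB drightN mulgV => ->.
      by have := F0 Z Z u 0 0; rewrite mulgV => ->; rewrite addrC.
    have Ad1 u : Ad 1%g u = u.
      rewrite -[LHS]/(dright 1^-1%g _ (dleft 1%g 1%g u)).
      by rewrite dleft1 invg1 dright1.
    by move=> Z u; have := F1 Z u; rewrite (F1 1%g u) Ad1 => /addrI/oppr_inj.
(* These are the right-hand sides at [X = 1]. By (a) the zero arguments are immaterial, and
   translation by [X^-1] in (b) and (c) brings every pair [(Xh, X)] to [(E, 1)]. *)
exists (fun E bt => - left_vect E bt - alpha E (output h y0 1%g) 0 0 0).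
exists (fun E _ => beta E (output h y0 1%g) 0 0 0).
move=> X Xh bh uy b t; split; last first.
  rewrite (betaR Xh X^-1%g) orbit_act_output mulgV.
  by have [_ ->] := indep_a (Xh * X^-1)%g (output h y0 1%g) bh 0 uy 0 t 0.
rewrite drightB drightN.
have -> : dright X^-1%g Xh (alpha Xh (output h y0 X) bh uy t) =
    alpha (Xh * X^-1)%g (output h y0 1%g) 0 0 0.
  rewrite [LHS]alphaR orbit_act_output mulgV.
  by have [-> _] := indep_a (Xh * X^-1)%g (output h y0 1%g) bh 0 uy 0 t 0.
congr (- _ - _).
(* Since [Xh = E X], the vector [T R_{X^-1} Xh[v]] is [E[Ad_X v]], which (d) reduces to [E[v]]. *)
have := dleftM (Xh * X^-1)%g X 1%g (bh - b); rewrite mulg1 mulgVK => <-.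
have := dleft_dright (Xh * X^-1)%g X^-1%g X (dleft X 1%g (bh - b)).
by rewrite mulgVK mulgV => <-; rewrite -[dright _ _ _]/(Ad X (bh - b)) Ad_id.
Qed.
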